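(* Let $X$ be a random variable on a finite set $\mathcal{X}$ with distribution $p_X$, and let $\mathcal{E}=\{(\rho_x,p_X(x))\}_{x\in\mathcal{X}}$ be a quantum ensemble of density matrices on a finite-dimensional Hilbert space $\mathcal{H}$. Then the quantum guesswork satisfies $$G(X|\mathcal{E})\ \ge\ \frac{2^{H(X)-\chi(\mathcal{E})}}{e}+\frac12,$$ where $H(X)$ is the Shannon entropy of $X$ in bits and $\chi(\mathcal{E})$ is the Holevo information of $\mathcal{E}$ in bits.
   Context: A POVM on $\mathcal{H}$ is a family $E=\{E_y\}_{y\in\mathcal{Y}}$, indexed by a finite set $\mathcal{Y}$ (which may depend on $E$), of positive semidefinite operators on $\mathcal{H}$ with $\sum_yE_y=I$. Given $\mathcal{E}$ and $E$, $Y_E$ is the $\mathcal{Y}$-valued random variable whose joint law with $X$ is $p_{X,Y_E}(x,y)=p_X(x)\operatorname{Tr}[E_y\rho_x]$. With $n=|\mathcal{X}|$, the classical conditional guessing entropy is $G(X|Y)=\mathbb{E}_Y\sum_{i=1}^n i\cdot p^{\downarrow}_{X|Y}(x_i|Y)$, where for each $y$ the numbers $p^{\downarrow}_{X|Y}(x_1|y)\ge\dots\ge p^{\downarrow}_{X|Y}(x_n|y)$ are the conditional probabilities $p_{X|Y}(x|y)$, $x\in\mathcal{X}$, sorted in descending order. The quantum guesswork is $G(X|\mathcal{E})=\inf_EG(X|Y_E)$, over all POVMs $E$ on $\mathcal{H}$. The Holevo information is $\chi(\mathcal{E})=S\bigl(\sum_xp_X(x)\rho_x\bigr)-\sum_xp_X(x)S(\rho_x)$,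 where $S(\rho)=-\sum_k\lambda_k\log_2\lambda_k$ (with $0\log_2 0=0$) is the von Neumann entropy of a density matrix $\rho$ with eigenvalues $\lambda_k$. *)

(* Defs.v *)
From HB Require Import structures.
From mathcomp Require Import all_boot all_order all_algebra.
From mathcomp Require Import spectral sesquilinear.
From mathcomp Require Import complex.
From mathcomp Require Import classical_sets reals exp.

Set Implicit Arguments.
Unset Strict Implicit.
Unset Printing Implicit Defensive.

Import Order.TTheory GRing.Theory Num.Theory.
Local Open Scope ring_scope.
Local Open Scope complex_scope.
Local Open Scope sesquilinear_scope.

(* The Hilbert space is C^d, with C = R[i]; operators are d x d matrices.
   The order of R[i] is the partial one: [0 <= z] means that z is real and
   nonnegative. *)

Section Classical.
Variable R : realType.

Definition log2 (x : R) : R := ln x / ln 2.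

Definition is_distribution (X : finType) (p : X -> R) : Prop :=
  (forall x, 0 <= p x) /\ \sum_x p x = 1.

Definition shannon_entropy (X : finType) (p : X -> R) : R :=
  - \sum_x p x * log2 (p x).

Section Guessing.
Variables (X Y : finType) (pXY : X -> Y -> R).

Definition marginalY (y : Y) : R := \sum_x pXY x y.

(* Equal to 0 when [marginalY y = 0], as division by 0 yields 0; such y have
   weight 0 in the expectation below. *)
Definition cond_prob (y : Y) (x : X) : R := pXY x y / marginalY y.

Definition sorted_cond_prob (y : Y) : seq R :=
  sort (fun a b : R => b <= a) [seq cond_prob y x | x <- enum X].

(* Ranks start at 1, whereas ordinals and [nth] start at 0. *)
Definition guessing_entropy : R :=
  \sum_y marginalY y *
    \sum_(i < #|X|) i.+1%:R * nth 0 (sorted_cond_prob y) i.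

End Guessing.
End Classical.

Section Quantum.
Variables (R : realType) (d : nat).

Definition psd (A : 'M[R[i]]_d) : Prop :=
  A \is hermsymmx /\
  forall v : 'cV[R[i]]_d, 0 <= (v ^t* *m A *m v) 0 0.

Definition is_density (rho : 'M[R[i]]_d) : Prop := psd rho /\ \tr rho = 1.

Definition is_povm (Y : finType) (E : Y -> 'M[R[i]]_d) : Prop :=
  (forall y, psd (E y)) /\ \sum_y E y = 1%:M.

(* [spectral_diag rho] lists the eigenvalues of the normal matrix rho with
   multiplicity; they are real when rho is Hermitian, so that taking real parts
   only changes their type. The convention 0 log 0 = 0 holds by the factor 0. *)
Definition von_neumann_entropy (rho : 'M[R[i]]_d) : R :=
  - \sum_(k < d) let lam := complex.Re (spectral_diag rho 0 k) in
      lam * log2 lam.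

Section Ensemble.
Variables (X : finType) (p : X -> R) (rho : X -> 'M[R[i]]_d).

Definition holevo_information : R :=
  von_neumann_entropy (\sum_x (p x)%:C *: rho x)
  - \sum_x p x * von_neumann_entropy (rho x).

(* The trace is real when E y and rho x are positive semidefinite. *)
Definition measured_joint (Y : finType) (E : Y -> 'M[R[i]]_d) (x : X) (y : Y)
    : R :=
  p x * complex.Re (\tr (E y *m rho x)).

Definition guesswork_values : set R :=
  [set g : R | exists (Y : finType) (E : Y -> 'M[R[i]]_d),
     is_povm E /\ g = guessing_entropy (measured_joint E)]%classic.

(* For an ensemble, [guesswork_values] is nonempty (take the POVM {I}) and
   bounded below by 0, so [inf] is its actual infimum. *)
Definition quantum_guesswork : R := inf guesswork_values.

End Ensemble.
End Quantum.

(* Main.v *)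
Require Import Defs.
From mathcomp Require Import all_boot all_order all_algebra.
From mathcomp Require Import spectral sesquilinear.
From mathcomp Require Import complex.
From mathcomp Require Import ring lra.
From mathcomp Require Import boolp classical_sets functions.
From mathcomp Require Import reals topology normedtype derive realfun sequences exp.

(* The argument has a classical and a quantum half, both in natural logarithms.

   Classical: for every joint law of (X, Y) with guessing entropy G, put
   m = G - 1/2. Comparing the sorted conditional laws with the weights
   exp(-(i - 1/2)/m)/m, whose sum over the ranks i >= 1 is
   1/(2 m sinh(1/(2 m))) <= 1, Gibbs' inequality gives H(X|Y) <= 1 + ln m.

   Quantum (Holevo's bound): chi is the average of the relative entropies
   D(rho_x || rho), and measuring does not increase D. With eigenvalues a_i of
   A, b_j of B and overlaps w_ij of the eigenbases,
   D(A || B) = sum w_ij a_i (ln a_i - ln b_j), and for each t > 0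
     sum w_ij a_i^2 / (b_j + t a_i)
       >= 2 tr(X A) - tr(X^2 B) - t tr(X^2 A)       (X Hermitian)
       >= sum_y p_y^2 / (q_y + t p_y)
   where p_y, q_y are the outcome probabilities and X = sum_y x_y E_y with
   x_y = p_y / (q_y + t p_y). Integrating over t yields the logarithms. *)

Set Implicit Arguments.
Unset Strict Implicit.
Unset Printing Implicit Defensive.

Import Order.TTheory GRing.Theory Num.Theory.
Import numFieldNormedType.Exports.
Local Open Scope ring_scope.
Local Open Scope complex_scope.
Local Open Scope sesquilinear_scope.

(** * Real inequalities *)

Section RealAnalysis.
Variable R : realType.
Implicit Types (x m : R) (I : finType).

Lemma is_derive_bigsum (I : Type) (r : seq I) (f : I -> R -> R) (df : I -> R)
    (x : R) :
  (forall i, is_derive x 1 (f i) (df i)) ->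
  is_derive x 1 (fun t => \sum_(i <- r) f i t) (\sum_(i <- r) df i).
Proof.
move=> fP; elim: r => [|i r IHr].
  rewrite big_nil (_ : (fun t => _) = cst 0); first exact: is_derive_cst.
  by apply/funext => t; rewrite big_nil.
rewrite big_cons (_ : (fun t => _) = f i \+ (fun t => \sum_(j <- r) f j t)).
  exact: is_deriveD.
by apply/funext => t; rewrite big_cons.
Qed.

Lemma derive_ge0_ge0 (f df : R -> R) x :
  (forall t : R, 0 <= t -> is_derive t 1 f (df t)) ->
  (forall t, 0 < t -> 0 <= df t) ->
  f 0 = 0 -> 0 <= x -> 0 <= f x.
Proof.
move=> fP df_ge0 f0 x_ge0; rewrite -f0; apply: (@ger0_derive1_ndecr _ f 0 x) => //.
- move=> t; rewrite in_itv /= => /andP[/ltW /fP t0 _]; exact: ex_derive.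
- move=> t; rewrite in_itv /= => /andP[t0 _].
  rewrite derive1E; have [_ ->] := fP t (ltW t0); exact: df_ge0.
- apply: derivable_within_continuous => t; rewrite in_itv /= => /andP[/fP ? _].
  exact: ex_derive.
Qed.

(** This is sinh x >= x: the derivative of the difference, e^t + e^(-t) - 2, is nonnegative by e^u
    >= 1 + u at u = t and u = -t. *)
Lemma twice_le_expRB x : 0 <= x -> 2 * x <= expR x - expR (- x).
Proof.
move=> x_ge0; rewrite -subr_ge0.
pose f t : R := expR t - expR (- t) - 2 * t.
apply: (@derive_ge0_ge0 f (fun t => expR t + expR (- t) - 2)) => //.
- move=> t _; apply: is_derive_eq.
  by rewrite /GRing.scale /= mulr1; ring.
- move=> t _; have := expR_ge1Dx t; have := expR_ge1Dx (- t); lra.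
- by rewrite /f oppr0 expR0; ring.
Qed.

Lemma ln_le_subr1 x : 0 < x -> ln x <= x - 1.
Proof.
move=> x0; have := @le_ln1Dx _ (x - 1).
by rewrite [1 + _]addrC subrK; apply; rewrite ltrBrDl subrr.
Qed.

(** Termwise, ln u <= u - 1 at u = r_i / s_i gives s_i (ln s_i - ln r_i) >= s_i - r_i, and these
    lower bounds have a nonnegative sum. The weights r may thus be subnormalized, like a truncated
    geometric series. *)
Lemma gibbs_le (n : nat) (s r : nat -> R) :
  (forall i, (i < n)%N -> 0 <= s i) -> (forall i, (i < n)%N -> 0 < r i) ->
  \sum_(i < n) r i <= \sum_(i < n) s i ->
  - \sum_(i < n) s i * ln (s i) <= - \sum_(i < n) s i * ln (r i).
Proof.
move=> s_ge0 r_gt0 le_rs; rewrite lerN2 -subr_ge0 -sumrB.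
apply: le_trans (_ : \sum_(i < n) (s i - r i) <= _); first by rewrite sumrB subr_ge0.
apply: ler_sum => i _; have ri := r_gt0 i (ltn_ord i).
have := s_ge0 i (ltn_ord i); rewrite le_eqVlt => /predU1P[<-|si].
  by rewrite !mul0r; lra.
have := @ln_le_subr1 (r i / s i) (divr_gt0 ri si).
rewrite ln_div // => /(ler_wpM2l (ltW si)).
by rewrite (_ : s i * (r i / s i - 1) = r i - s i); [lra|field; rewrite gt_eqF].
Qed.

(** Induction on the telescoping bound 1 - e^(-n/m). With the midpoint factor e^(-(i + 1/2)/m) taken
    out, the increment inequality reads 1/m <= 2 sinh(1/(2m)). *)
Lemma sum_geometric_le1 m (n : nat) : 0 < m ->
  \sum_(i < n) expR (- (i%:R + 1 / 2) / m) / m <= 1.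
Proof.
move=> m0; apply: le_trans (_ : 1 - expR (- n%:R / m) <= _); last first.
  by rewrite gerBl expR_ge0.
elim: n => [|n IHn]; first by rewrite big_ord0 oppr0 mul0r expR0 subrr.
rewrite big_ord_recr /=.
suff: expR (- (n%:R + 1 / 2) / m) / m
    <= expR (- n%:R / m) - expR (- n.+1%:R / m) by lra.
have -> : - n%:R / m = - (n%:R + 1 / 2) / m + 1 / 2 / m by field; rewrite gt_eqF.
have -> : - n.+1%:R / m = - (n%:R + 1 / 2) / m + - (1 / 2 / m).
  by rewrite -natr1; field; rewrite gt_eqF.
rewrite !expRD -mulrBr ler_pM2l ?expR_gt0 //.
apply: le_trans (@twice_le_expRB (1 / 2 / m) _); last by rewrite !divr_ge0 // ltW.
by rewrite (_ : 2 * _ = m^-1) //; field; rewrite gt_eqF.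
Qed.

(* Here ranks are shifted to start at 0: the comparison weights are
   exp(-(i + 1/2)/m)/m. *)
Lemma entropy_le_mean_rank m (n : nat) (s : nat -> R) : 0 < m ->
  (forall i, (i < n)%N -> 0 <= s i) -> \sum_(i < n) s i = 1 ->
  - \sum_(i < n) s i * ln (s i)
    <= (\sum_(i < n) i.+1%:R * s i - 1 / 2) / m + ln m.
Proof.
move=> m0 s_ge0 s1.
pose r (i : nat) := expR (- (i%:R + 1 / 2) / m) / m.
apply: le_trans (@gibbs_le n s r s_ge0 _ _) _ => [i _||].
- by rewrite divr_gt0 ?expR_gt0.
- by rewrite s1 sum_geometric_le1.
have -> : (\sum_(i < n) i.+1%:R * s i - 1 / 2) / m + ln m
  = \sum_(i < n) ((i.+1%:R * s i - 1 / 2 * s i) / m + ln m * s i).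
  by rewrite big_split /= -mulr_suml sumrB -!mulr_sumr s1 !mulr1.
rewrite -sumrN; apply: ler_sum => i _.
rewrite /r ln_div ?posrE ?expR_gt0 // expRK -natr1.
by rewrite le_eqVlt; apply/orP; left; apply/eqP; field; rewrite gt_eqF.
Qed.

(* The sum of the [e i * (ln (b i + t * a i) - ln (b i))] vanishes at t = 0 and has
   nonnegative derivative in t. As t goes to infinity, [ln (b i + t * a i)] is
   [ln t + ln (a i) + O(1 / t)], and the [ln t] terms cancel as the e i sum to 0. *)
Lemma log_ratio_sum_ge0_pos (I : finType) (e a b : I -> R) :
  (forall i, 0 < a i) -> (forall i, 0 < b i) -> \sum_i e i = 0 ->
  (forall t, 0 < t -> 0 <= \sum_i e i * (a i / (b i + t * a i))) ->
  0 <= \sum_i e i * (ln (a i) - ln (b i)).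
Proof.
move=> a0 b0 e0 F_ge0.
pose g t := \sum_i e i * (ln (b i + t * a i) - ln (b i)).
have g_ge0 t : 0 <= t -> 0 <= g t.
  apply: (@derive_ge0_ge0 g (fun t => \sum_i e i * (a i / (b i + t * a i)))) => //.
    move=> u u0; apply: is_derive_bigsum => i.
    have bu : 0 < b i + u * a i by rewrite ltr_pwDl // mulr_ge0 // ltW.
    have dl : is_derive (b i + u * a i) 1 (@ln R) (b i + u * a i)^-1.
      exact: is_derive1_ln.
    have da : is_derive u 1 (fun v => b i + v * a i) (a i).
      by apply: is_derive_eq; rewrite /GRing.scale /=; ring.
    have dc := @is_derive1_comp _ (@ln R) (fun v => b i + v * a i) u _ _ dl da.
    rewrite (_ : (fun t => _) =
      (e i) \*: (((@ln R) \o (fun v => b i + v * a i)) \- cst (ln (b i)))) //.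
    apply: is_derive_eq; rewrite /GRing.scale /=; ring.
  by rewrite /g big1 // => i _; rewrite mul0r addr0 subrr mulr0.
(* C / t will bound the O(1 / t) error: 0 <= ln (1 + u) <= u with u = b_i / (a_i t). The absolute
   value is there because e_i may have either sign. *)
pose C := \sum_i `|e i| * (b i / a i).
have C_ge0 : 0 <= C.
  by apply: sumr_ge0 => i _; rewrite mulr_ge0 // divr_ge0 // ltW.
set D := \sum_i _.
have step t : 0 < t -> - (C / t) <= D.
  move=> t0; have := g_ge0 t (ltW t0); suff: g t <= D + C / t by lra.
  have -> : g t = \sum_i e i * (ln (b i / t + a i) - ln (b i)).
    transitivity (\sum_i (e i * (ln (b i / t + a i) - ln (b i)) + e i * ln t)).
      apply: eq_bigr => i _.
      have -> : b i + t * a i = t * (b i / t + a i) by field; rewrite gt_eqF.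
      by rewrite lnM ?posrE ?addr_gt0 ?divr_gt0 //; ring.
    by rewrite big_split /= -mulr_suml e0 mul0r addr0.
  rewrite /D /C mulr_suml -big_split /=; apply: ler_sum => i _.
  have ai := a0 i; have bi := b0 i; have bt : 0 < b i / t by rewrite divr_gt0.
  have -> : b i / t + a i = a i * (1 + b i / a i / t) by field; rewrite !gt_eqF.
  have x0 : 0 < b i / a i / t by rewrite !divr_gt0.
  rewrite lnM ?posrE ?ltr_pwDl // ?(ltW x0) //.
  have l1 : ln (1 + b i / a i / t) <= b i / a i / t by apply: le_ln1Dx; lra.
  have l0 : 0 <= ln (1 + b i / a i / t) by apply: ln_ge0; lra.
  have: e i * ln (1 + b i / a i / t) <= `|e i| * (b i / a i / t).
    exact: le_trans (ler_wpM2r l0 (ler_norm _)) (ler_wpM2l (normr_ge0 _) l1).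
  lra.
rewrite leNgt; apply/negP => D0.
(* At this t, C / t = -D C / (C + 1) < -D, which contradicts [step]. *)
have := step ((C + 1) / (- D)); rewrite divr_gt0 ?oppr_gt0 ?ltr_wpDl // => /(_ isT).
rewrite leNgt => /negP; apply.
rewrite ltrNr ltr_pdivrMr ?divr_gt0 ?oppr_gt0 ?ltr_wpDl //.
by rewrite mulrC divfK ?oppr_eq0 ?lt_eqF //; lra.
Qed.
(** Where e i = 0, a i or b i may vanish; replacing both by 1 there changes neither sum and makes
    the strictly positive case apply. *)
Lemma log_ratio_sum_ge0 (I : finType) (e a b : I -> R) :
  (forall i, e i != 0 -> 0 < a i) -> (forall i, e i != 0 -> 0 < b i) ->
  \sum_i e i = 0 ->
  (forall t, 0 < t -> 0 <= \sum_i e i * (a i / (b i + t * a i))) ->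
  0 <= \sum_i e i * (ln (a i) - ln (b i)).
Proof.
move=> a0 b0 e0 F0.
pose on (f : I -> R) i := if e i == 0 then 1 else f i.
have onE (f : I -> R -> R -> R) (a' := on a) (b' := on b) :
  \sum_i e i * f i (a i) (b i) = \sum_i e i * f i (a' i) (b' i).
  by apply: eq_bigr => i _; rewrite /a' /b' /on; case: eqP => // ->; rewrite !mul0r.
rewrite (onE (fun _ a b => ln a - ln b)).
apply: log_ratio_sum_ge0_pos => // [i|i|t /F0].
- by rewrite /on; case: ifPn => // /a0.
- by rewrite /on; case: ifPn => // /b0.
- by rewrite (onE (fun _ a b => a / (b + t * a))).
Qed.

End RealAnalysis.

(** * Positive semidefinite matrices *)

Section ComplexParts.
Variable R : realType.
Implicit Types (z w : R[i]) (x : R).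

Definition sqnormc z : R := complex.Re z ^+ 2 + complex.Im z ^+ 2.

Lemma sqnormc_ge0 z : 0 <= sqnormc z.
Proof. by rewrite addr_ge0 ?sqr_ge0. Qed.

Lemma mulc_conj z : z * z^*%R = (sqnormc z)%:C.
Proof. by case: z => a b; rewrite /sqnormc; simpc; congr (_ +i* _); ring. Qed.

Lemma conjC_real_complex x : (x%:C)^*%R = x%:C.
Proof. exact: conjc_real. Qed.

Lemma ReD z w : complex.Re (z + w) = complex.Re z + complex.Re w.
Proof. by case: z w => [? ?] [? ?]. Qed.

Lemma ReN z : complex.Re (- z) = - complex.Re z.
Proof. by case: z. Qed.

Lemma ReZ x z : complex.Re (x%:C * z) = x * complex.Re z.
Proof. by case: z => a b; rewrite /= mul0r subr0. Qed.

Lemma Re_sum (I : Type) (r : seq I) (P : pred I) (F : I -> R[i]) :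
  complex.Re (\sum_(i <- r | P i) F i) = \sum_(i <- r | P i) complex.Re (F i).
Proof. exact: (big_morph _ ReD erefl). Qed.

Lemma Re_ge0 z : 0 <= z -> 0 <= complex.Re z.
Proof. by rewrite lecE => /andP[]. Qed.

Lemma ge0_ReK z : 0 <= z -> (complex.Re z)%:C = z.
Proof. by move=> /ger0_real /RRe_real. Qed.

End ComplexParts.

Section Psd.
Variables (R : realType) (d : nat).
Local Notation M := 'M[R[i]]_d.
Implicit Types (A B X : M) (v : 'cV[R[i]]_d).

Lemma trmxC_mul m n p (A : 'M[R[i]]_(m, n)) (B : 'M_(n, p)) :
  (A *m B)^t* = B^t* *m A^t*.
Proof. by rewrite trmx_mul map_mxM. Qed.

Lemma hermsymmx_trmxC A : (A \is hermsymmx) = (A^t* == A).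
Proof. by rewrite qualifE /= expr0 scale1r eq_sym. Qed.

Lemma psd0 : @psd R d 0.
Proof.
split; first by rewrite hermsymmx_trmxC trmx0 map_mx0.
by move=> v; rewrite mulmx0 mul0mx mxE.
Qed.

Lemma psdD A B : psd A -> psd B -> psd (A + B).
Proof.
move=> [Ah A0] [Bh B0]; split => [|v].
  move: Ah Bh; rewrite !hermsymmx_trmxC linearD map_mxD /=.
  by move=> /eqP -> /eqP ->.
by rewrite mulmxDr mulmxDl mxE addr_ge0.
Qed.

Lemma psdZ (c : R) A : 0 <= c -> psd A -> psd (c%:C *: A).
Proof.
move=> c0 [Ah A0]; split => [|v].
  move: Ah; rewrite !hermsymmx_trmxC linearZ map_mxZ /= => /eqP ->.
  by rewrite conjC_real_complex.
by rewrite -scalemxAr -scalemxAl mxE mulr_ge0 // ler0c.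
Qed.

Lemma psd_sum (I : Type) (r : seq I) (P : pred I) (F : I -> M) :
  (forall i, P i -> psd (F i)) -> psd (\sum_(i <- r | P i) F i).
Proof. exact: (big_ind (@psd R d) psd0 psdD). Qed.

Lemma psd_conj X A : psd A -> psd (X^t* *m A *m X).
Proof.
move=> [Ah A0]; split => [|v].
  move: Ah; rewrite !hermsymmx_trmxC !trmxC_mul trmxCK => /eqP ->.
  by rewrite mulmxA.
by rewrite !mulmxA -trmxC_mul -!mulmxA mulmxA A0.
Qed.

Definition eig A (k : 'I_d) : R := complex.Re (spectral_diag A 0 k).

(** For unitary X, the diagonal of A in the orthonormal basis of columns of [X^t*]. Taken at
    [spectralmx B] and weighted by ln b_k, it gives tr(A ln B). *)
Definition diag_coef X A (k : 'I_d) : R[i] := (X *m A *m X^t*) k k.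

Lemma diag_coef_psd X A k : psd A -> 0 <= diag_coef X A k.
Proof.
move=> [_ A0]; have := A0 ((row k X)^t*); rewrite trmxCK -row_mul.
by congr (0 <= _); rewrite /diag_coef !mxE; apply: eq_bigr => j _; rewrite !mxE.
Qed.

Lemma spectral_diagE A : A \is normalmx ->
  spectralmx A *m A *m (spectralmx A)^t* = diag_mx (spectral_diag A).
Proof.
move=> /orthomx_spectralP; set U := spectralmx A => {1}->.
have Uu := spectral_unitarymx A.
rewrite invmx_unitary // !mulmxA (unitarymxP Uu) mul1mx -mulmxA.
by rewrite (unitarymxP Uu) mulmx1.
Qed.

Lemma psd_normal A : psd A -> A \is normalmx.
Proof. by move=> [/hermitian_normalmx]. Qed.

Lemma psd_spectral_ge0 A k : psd A -> 0 <= spectral_diag A 0 k.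
Proof.
move=> A0; have := @diag_coef_psd (spectralmx A) A k A0.
by rewrite /diag_coef spectral_diagE ?psd_normal // !mxE eqxx mulr1n.
Qed.

Lemma eig_ge0 A k : psd A -> 0 <= eig A k.
Proof. by move=> A0; apply/Re_ge0/psd_spectral_ge0. Qed.

Lemma eigE A k : psd A -> spectral_diag A 0 k = (eig A k)%:C.
Proof. by move=> A0; rewrite ge0_ReK //; apply: psd_spectral_ge0. Qed.

Lemma diag_coef_spectral A k : psd A ->
  diag_coef (spectralmx A) A k = (eig A k)%:C.
Proof.
move=> A0; rewrite -eigE // /diag_coef spectral_diagE ?psd_normal //.
by rewrite !mxE eqxx mulr1n.
Qed.

Lemma mxtrace_spectral X A : psd A ->
  \tr (X *m A) = \sum_k diag_coef (spectralmx A) X k * (eig A k)%:C.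
Proof.
move=> A0; set U := spectralmx A; have Uu := spectral_unitarymx A.
have -> : X *m A = X *m U^t* *m diag_mx (spectral_diag A) *m U.
  by have /orthomx_spectralP {1}-> := psd_normal A0; rewrite invmx_unitary // !mulmxA.
rewrite mxtrace_mulC !mulmxA; apply: eq_bigr => k _.
by rewrite mul_mx_diag mxE eigE.
Qed.

Lemma mxtrace_psd_ge0 A B : psd A -> psd B -> 0 <= \tr (A *m B).
Proof.
move=> A0 B0; rewrite mxtrace_spectral //; apply: sumr_ge0 => k _.
by rewrite mulr_ge0 ?diag_coef_psd // ler0c eig_ge0.
Qed.

End Psd.

(** * Relative entropy under a measurement *)

Section Overlap.
Variables (R : realType) (d : nat).
Local Notation M := 'M[R[i]]_d.
Implicit Types (A B X : M) (t : R).

(** The squared modulus of the inner product of the i-th eigenvector of A and the j-th eigenvector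
    of B. *)
Definition overlap A B (i j : 'I_d) : R :=
  sqnormc ((spectralmx A *m (spectralmx B)^t*) i j).

Lemma overlap_ge0 A B i j : 0 <= overlap A B i j.
Proof. exact: sqnormc_ge0. Qed.

Lemma unitarymx_trmxC_mul (U : M) : U \is unitarymx -> U^t* *m U = 1%:M.
Proof. by move=> Uu; apply: mulmx1C; apply/unitarymxP. Qed.

(** A row of a product of unitary matrices has norm 1. *)
Lemma sum_overlap A B i : \sum_j overlap A B i j = 1.
Proof.
have Wu := mul_unitarymx (spectral_unitarymx A)
  (etrans (trmxC_unitary (spectralmx B)) (spectral_unitarymx B)).
have /unitarymxP/matrixP/(_ i i) := Wu; rewrite [in RHS]mxE eqxx mulr1n mxE.
move=> /(congr1 (@complex.Re R)); rewrite Re_sum /= => <-.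
by apply: eq_bigr => j _; rewrite [_^t* _ _]mxE [_^T _ _]mxE mulc_conj.
Qed.

Lemma diag_coef_overlap A B j : psd A ->
  complex.Re (diag_coef (spectralmx B) A j) = \sum_i overlap A B i j * eig A i.
Proof.
move=> A0; set U := spectralmx A; set V := spectralmx B.
have Uu : U \is unitarymx := spectral_unitarymx A.
have -> : diag_coef V A j =
    ((U *m V^t*)^t* *m diag_mx (spectral_diag A) *m (U *m V^t*)) j j.
  have /orthomx_spectralP {1}-> := psd_normal A0.
  by rewrite /diag_coef (invmx_unitary Uu) trmxC_mul trmxCK -!mulmxA.
rewrite mxE Re_sum; apply: eq_bigr => i _.
rewrite mul_mx_diag mxE eigE // [_^t* _ _]mxE [_^T _ _]mxE mulrAC.
by rewrite [X in X * _]mulrC mulc_conj mulrC ReZ /= mulrC.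
Qed.

(** With k = b + c a, right side minus left side is |k z - a w|^2 / k. The case a = 0 is separate
    because k may then vanish. *)
Lemma complete_square (a b c : R) (z w : R[i]) :
  0 <= a -> 0 <= b -> 0 < c ->
  2 * (a * complex.Re (z * w^*%R)) - (b + c * a) * sqnormc z
    <= sqnormc w * a * (a / (b + c * a)).
Proof.
move=> a0 b0 c0; have [->|an0] := eqVneq a 0.
  rewrite !(mul0r, mulr0, addr0, sub0r) oppr_le0.
  by rewrite mulr_ge0 ?sqnormc_ge0.
have ap : 0 < a by rewrite lt_def an0.
have k0 : 0 < b + c * a by rewrite ltr_wpDl // mulr_gt0.
move: (b + c * a) k0 => k k0.
case: z w => [zr zi] [wr wi]; rewrite /sqnormc /=.
rewrite -subr_ge0.
have -> : (wr ^+ 2 + wi ^+ 2) * a * (a / k)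
   - (2 * (a * (zr * wr - zi * - wi)) - k * (zr ^+ 2 + zi ^+ 2))
   = ((k * zr - a * wr) ^+ 2 + (k * zi - a * wi) ^+ 2) / k.
  by field; rewrite gt_eqF.
by rewrite divr_ge0 ?addr_ge0 ?sqr_ge0 // ltW.
Qed.

(** In the mixed matrix elements Z_ij of X and W_ij of the identity, between the eigenbases of A and
    B, all three traces become sums over pairs (i, j), as X^2 = X X^* for Hermitian X. The square is
    then completed for each pair. *)
Lemma quadratic_le_overlap (A B X : M) t :
  psd A -> psd B -> X^t* = X -> 0 < t ->
  2 * complex.Re (\tr (X *m A)) - complex.Re (\tr (X *m X *m B))
    - t * complex.Re (\tr (X *m X *m A))
  <= \sum_(k : 'I_d * 'I_d) overlap A B k.1 k.2 * eig A k.1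
       * (eig A k.1 / (eig B k.2 + t * eig A k.1)).
Proof.
move=> A0 B0 Xh t0; set U := spectralmx A; set V := spectralmx B.
have UuC : U^t* *m U = 1%:M by apply/unitarymx_trmxC_mul/spectral_unitarymx.
have VuC : V^t* *m V = 1%:M by apply/unitarymx_trmxC_mul/spectral_unitarymx.
pose Z := U *m X *m V^t*; pose W := U *m V^t*.
have trXA : complex.Re (\tr (X *m A))
    = \sum_i \sum_j eig A i * complex.Re (Z i j * (W i j)^*%R).
  rewrite mxtrace_spectral // Re_sum; apply: eq_bigr => i _.
  rewrite mulrC ReZ -mulr_sumr; congr (_ * _).
  have -> : diag_coef U X i = (Z *m W^t*) i i.
    by rewrite trmxC_mul trmxCK -mulmxA [V^t* *m _]mulmxA VuC mul1mx.
  rewrite mxE Re_sum; apply: eq_bigr => j _.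
  by rewrite [_^t* _ _]mxE [_^T _ _]mxE.
have trXXA : complex.Re (\tr (X *m X *m A))
    = \sum_i \sum_j eig A i * sqnormc (Z i j).
  rewrite mxtrace_spectral // Re_sum; apply: eq_bigr => i _.
  rewrite mulrC ReZ -mulr_sumr; congr (_ * _).
  have -> : diag_coef U (X *m X) i = (Z *m Z^t*) i i.
    rewrite /Z !trmxC_mul trmxCK Xh /diag_coef -!mulmxA.
    by rewrite [V^t* *m _]mulmxA VuC mul1mx.
  rewrite mxE Re_sum; apply: eq_bigr => j _.
  by rewrite [_^t* _ _]mxE [_^T _ _]mxE mulc_conj.
have trXXB : complex.Re (\tr (X *m X *m B))
    = \sum_i \sum_j eig B j * sqnormc (Z i j).
  rewrite mxtrace_spectral // Re_sum exchange_big; apply: eq_bigr => j _ /=.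
  rewrite mulrC ReZ -mulr_sumr; congr (_ * _).
  have -> : diag_coef V (X *m X) j = (Z^t* *m Z) j j.
    rewrite /Z !trmxC_mul trmxCK Xh /diag_coef -!mulmxA.
    by rewrite [U^t* *m _]mulmxA UuC mul1mx.
  rewrite mxE Re_sum; apply: eq_bigr => i _.
  by rewrite [_^t* _ _]mxE [_^T _ _]mxE mulrC mulc_conj.
rewrite trXA trXXA trXXB !pair_bigA /= !mulr_sumr -!sumrB.
apply: ler_sum => -[i j] _ /=.
apply: le_trans (complete_square (Z i j) (W i j) (eig_ge0 i A0) (eig_ge0 j B0) t0).
by rewrite le_eqVlt; apply/orP; left; apply/eqP; ring.
Qed.


Lemma mxtrace_sum (I : finType) (F : I -> M) : \tr (\sum_i F i) = \sum_i \tr (F i).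
Proof. exact: raddf_sum. Qed.

Lemma mxtraceB A B : \tr (A - B) = \tr A - \tr B.
Proof. exact: raddfB. Qed.

Lemma subr_perm (V : zmodType) (a b c e : V) : a - b - (c - e) = a - c - b + e.
Proof. by rewrite opprB addrA addrAC; congr (_ + _); exact: addrAC. Qed.

Section Measurement.
Variables (Y : finType) (E : Y -> M).
Hypothesis E_povm : is_povm E.
Let E_psd y : psd (E y) := E_povm.1 y.

Definition outcome_prob A (y : Y) : R := complex.Re (\tr (E y *m A)).

Lemma outcome_prob_ge0 A y : psd A -> 0 <= outcome_prob A y.
Proof. by move=> A0; exact: Re_ge0 (mxtrace_psd_ge0 (E_psd y) A0). Qed.

Lemma sum_outcome_prob A : \sum_y outcome_prob A y = complex.Re (\tr A).
Proof.
by rewrite -Re_sum -mxtrace_sum -mulmx_suml E_povm.2 mul1mx.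
Qed.

Definition povm_observable (x : Y -> R) : M := \sum_y (x y)%:C *: E y.

Lemma povm_observable_trmxC (x : Y -> R) : (povm_observable x)^t* = povm_observable x.
Proof.
rewrite /povm_observable raddf_sum map_mx_sum; apply: eq_bigr => y _.
rewrite /= linearZ map_mxZ /= conjC_real_complex.
by have [] := E_psd y; rewrite hermsymmx_trmxC => /eqP ->.
Qed.

Lemma tr_povm_observable (x : Y -> R) A :
  complex.Re (\tr (povm_observable x *m A)) = \sum_y x y * outcome_prob A y.
Proof.
rewrite mulmx_suml mxtrace_sum Re_sum; apply: eq_bigr => y _.
by rewrite -scalemxAl mxtraceZ ReZ.
Qed.

(* Kadison's inequality for the POVM: with [X = \sum x_y E_y], the operator
   [\sum x_y^2 E_y - X^2] equals [\sum (X - x_y) E_y (X - x_y)]. *)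
Lemma tr_povm_observable_sqr (x : Y -> R) A : psd A ->
  complex.Re (\tr (povm_observable x *m povm_observable x *m A))
    <= \sum_y x y ^+ 2 * outcome_prob A y.
Proof.
move=> A0; set X := povm_observable x.
have Xh : X^t* = X by exact: povm_observable_trmxC.
pose D y := X - (x y)%:C%:M.
have Dh y : (D y)^t* = D y.
  by rewrite /D raddfB /= map_mxB Xh tr_scalar_mx map_scalar_mx /= conjC_real_complex.
have DE : \sum_y (D y)^t* *m E y *m D y = \sum_y (x y ^+ 2)%:C *: E y - X *m X.
  transitivity (\sum_y (X *m E y *m X - X *m ((x y)%:C *: E y)
      - ((x y)%:C *: E y) *m X + (x y ^+ 2)%:C *: E y)).
    apply: eq_bigr => y _; rewrite Dh /D.
    rewrite mulmxBl !mulmxBr mulmxBl mul_scalar_mx !mul_mx_scalar.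
    rewrite scalerBr scalerA -rmorphM -expr2 -scalemxAr -scalemxAl.
    exact: subr_perm.
  rewrite big_split !sumrB -mulmx_suml -!mulmx_sumr -mulmx_suml E_povm.2 mulmx1.
  by rewrite -/X /= subrr sub0r addrC.
have: 0 <= \tr (\sum_y (D y)^t* *m E y *m D y *m A).
  rewrite mxtrace_sum; apply: sumr_ge0 => y _.
  exact: mxtrace_psd_ge0 (psd_conj (D y) (E_psd y)) A0.
rewrite -mulmx_suml DE mulmxBl mxtraceB => /Re_ge0; rewrite ReD ReN subr_ge0.
move=> /le_trans; apply; rewrite mulmx_suml mxtrace_sum Re_sum; apply: ler_sum => y _.
by rewrite -scalemxAl mxtraceZ ReZ.
Qed.

(** The chosen x_y maximizes 2 x p_y - x^2 (q_y + t p_y), with maximum p_y^2 / (q_y + t p_y).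
    Kadison's inequality brings the two traces of X^2 into this form. *)
Lemma measured_chi2_le A B t : psd A -> psd B -> 0 < t ->
  \sum_y outcome_prob A y * (outcome_prob A y / (outcome_prob B y + t * outcome_prob A y))
  <= \sum_(k : 'I_d * 'I_d) overlap A B k.1 k.2 * eig A k.1
       * (eig A k.1 / (eig B k.2 + t * eig A k.1)).
Proof.
move=> A0 B0 t0.
pose x y := outcome_prob A y / (outcome_prob B y + t * outcome_prob A y).
apply: le_trans (quadratic_le_overlap A0 B0 (povm_observable_trmxC x) t0).
have := tr_povm_observable_sqr x A0; have := tr_povm_observable_sqr x B0.
move=> lB /(ler_wpM2l (ltW t0)) lA; rewrite tr_povm_observable.
suff: \sum_y outcome_prob A y * x y <= 2 * \sum_y x y * outcome_prob A y -
  \sum_y x y ^+ 2 * outcome_prob B y - t * \sum_y x y ^+ 2 * outcome_prob A y.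
  by lra.
rewrite !mulr_sumr -!sumrB; apply: ler_sum => y _; rewrite /x.
have := outcome_prob_ge0 y A0; have := outcome_prob_ge0 y B0.
move: (outcome_prob B y) (outcome_prob A y) => q p q0.
(* If p_y = 0 the denominator may be 0, but then every term vanishes. *)
rewrite le_eqVlt => /predU1P[<-|p0].
  by rewrite !(mul0r, mulr0, subr0, expr0n).
rewrite le_eqVlt; apply/orP; left; apply/eqP.
by field; rewrite gt_eqF // ltr_wpDl // mulr_gt0.
Qed.

(** The domination A <= c B is a support condition: it keeps both relative entropies finite, so that
    the value of [ln] at 0 never matters. *)
Lemma measured_relative_entropy_le A B (c : R) :
  psd A -> psd B -> psd (c%:C *: B - A) ->
  \sum_y outcome_prob A y * (ln (outcome_prob A y) - ln (outcome_prob B y))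
  <= \sum_i eig A i * ln (eig A i)
     - \sum_j complex.Re (diag_coef (spectralmx B) A j) * ln (eig B j).
Proof.
move=> A0 B0 cBA0.
have -> : \sum_i eig A i * ln (eig A i)
     - \sum_j complex.Re (diag_coef (spectralmx B) A j) * ln (eig B j)
  = \sum_(k : 'I_d * 'I_d) overlap A B k.1 k.2 * eig A k.1
       * (ln (eig A k.1) - ln (eig B k.2)).
  rewrite -(pair_bigA _ (fun i j =>
    overlap A B i j * eig A i * (ln (eig A i) - ln (eig B j)))) /=.
  under [RHS]eq_bigr => i _ do
    (under eq_bigr => j _ do rewrite mulrBr; rewrite sumrB).
  rewrite sumrB; congr (_ - _).
    apply: eq_bigr => i _; rewrite -!mulr_suml sum_overlap mul1r //.
  rewrite exchange_big /=; apply: eq_bigr => j _.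
  by rewrite diag_coef_overlap // mulr_suml.
(* Testing the domination against E_y, and below against the j-th eigenvector of B, shows that q_y =
   0 forces p_y = 0, and that b_j = 0 forces w_ij a_i = 0 for all i. *)
have q_dom y : outcome_prob A y <= c * outcome_prob B y.
  have := mxtrace_psd_ge0 (E_psd y) cBA0.
  rewrite mulmxBr -scalemxAr mxtraceB mxtraceZ => /Re_ge0.
  by rewrite ReD ReN ReZ subr_ge0.
have b_dom j : \sum_i overlap A B i j * eig A i <= c * eig B j.
  have := diag_coef_psd (spectralmx B) j cBA0.
  rewrite -diag_coef_overlap // /diag_coef mulmxBr mulmxBl -scalemxAr -scalemxAl.
  rewrite [X in 0 <= X]mxE [X in _ + X]mxE [X in X - _]mxE -!/(diag_coef _ _ _).
  by rewrite diag_coef_spectral // => /Re_ge0; rewrite ReD ReN ReZ subr_ge0.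
(* Both sides are merged into one signed family, with weights w_ij a_i on pairs and -p_y on
   outcomes. The total is tr A - tr A = 0, and the condition for each t is [measured_chi2_le]. *)
pose e (k : 'I_d * 'I_d + Y) := match k with
  | inl k => overlap A B k.1 k.2 * eig A k.1 | inr y => - outcome_prob A y end.
pose a (k : 'I_d * 'I_d + Y) :=
  match k with inl k => eig A k.1 | inr y => outcome_prob A y end.
pose b (k : 'I_d * 'I_d + Y) :=
  match k with inl k => eig B k.2 | inr y => outcome_prob B y end.
rewrite -subr_ge0 -sumrN; under [X in 0 <= _ + X]eq_bigr do rewrite -mulNr.
have := @log_ratio_sum_ge0 R _ e a b; rewrite !big_sumType; apply.
- case=> [[i j]|y] /=.
    rewrite mulf_eq0 negb_or => /andP[_ ai]; by rewrite lt_def ai eig_ge0.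
  by rewrite oppr_eq0 => p0; rewrite lt_def p0 outcome_prob_ge0.
- case=> [[i j]|y] /= ne0.
    rewrite lt_def eig_ge0 // andbT; apply: contra ne0 => /eqP bj0.
    have := b_dom j; rewrite bj0 mulr0 => le0.
    rewrite eq_le (le_trans _ le0) ?mulr_ge0 ?overlap_ge0 ?eig_ge0 //.
    rewrite (bigD1 i) //= lerDl; apply: sumr_ge0 => k _.
    by rewrite mulr_ge0 ?overlap_ge0 ?eig_ge0.
  rewrite lt_def outcome_prob_ge0 // andbT; move: ne0; rewrite oppr_eq0.
  apply: contra => /eqP q0; have := q_dom y; rewrite q0 mulr0 => le0.
  by rewrite eq_le le0 outcome_prob_ge0.
- rewrite sumrN sum_outcome_prob -(mul1mx A) mxtrace_spectral // Re_sum.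
  rewrite -(pair_bigA _ (fun i j => overlap A B i j * eig A i)) /=.
  rewrite -sumrB big1 // => i _; rewrite -mulr_suml sum_overlap.
  rewrite /diag_coef mulmx1 (unitarymxP (spectral_unitarymx A)) mxE eqxx.
  by rewrite !mul1r subrr.
- move=> t t0; rewrite big_sumType /=; have := measured_chi2_le A0 B0 t0.
  by rewrite -subr_ge0 -sumrN; under [X in 0 <= _ + X]eq_bigr do rewrite -mulNr.
Qed.

End Measurement.
End Overlap.

(** * Guessing entropy and the Holevo bound *)

Lemma psd1 (R : realType) d : @psd R d 1%:M.
Proof.
split=> [|v]; first by rewrite hermsymmx_trmxC trmx1 map_mx1.
rewrite mulmx1 mxE; apply: sumr_ge0 => i _.
by rewrite [_^t* _ _]mxE [_^T _ _]mxE mulrC mulc_conj ler0c sqnormc_ge0.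
Qed.

Section GuessingEntropy.
Variables (R : realType) (X Y : finType) (P : X -> Y -> R).
Hypotheses (P_ge0 : forall x y, 0 <= P x y) (P_sum1 : \sum_x \sum_y P x y = 1).

Lemma marginalY_ge0 y : 0 <= marginalY P y.
Proof. exact: sumr_ge0. Qed.

Lemma sum_marginalY : \sum_y marginalY P y = 1.
Proof. by rewrite exchange_big. Qed.

Lemma cond_prob_ge0 y x : 0 <= cond_prob P y x.
Proof. by rewrite divr_ge0 ?marginalY_ge0. Qed.

Lemma size_sorted_cond_prob y : size (sorted_cond_prob P y) = #|X|.
Proof. by rewrite size_sort size_map -cardE. Qed.

Lemma sum_sorted_cond_prob y (f : R -> R) :
  \sum_(i < #|X|) f (nth 0 (sorted_cond_prob P y) i) = \sum_x f (cond_prob P y x).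
Proof.
rewrite -(size_sorted_cond_prob y) -(big_mkord xpredT (fun i => f (nth 0 _ i))).
rewrite -(big_nth 0 xpredT f) (perm_big _ (permEl (perm_sort _ _))) big_map.
by rewrite big_enum.
Qed.

Lemma nth_sorted_cond_prob_ge0 y i : 0 <= nth 0 (sorted_cond_prob P y) i.
Proof.
have [lt_i|?] := ltnP i (size (sorted_cond_prob P y)); last by rewrite nth_default.
have := mem_nth 0 lt_i; rewrite mem_sort => /mapP[x _ ->].
exact: cond_prob_ge0.
Qed.

Lemma sum_nth_sorted_cond_prob y : 0 < marginalY P y ->
  \sum_(i < #|X|) nth 0 (sorted_cond_prob P y) i = 1.
Proof.
move=> q0; rewrite (sum_sorted_cond_prob y id) -mulr_suml.
by rewrite -/(marginalY P y) divff ?gt_eqF.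
Qed.

(** Every rank is at least 1. This makes m = G - 1/2 positive. *)
Lemma guessing_entropy_ge1 : 1 <= guessing_entropy P.
Proof.
rewrite -sum_marginalY; apply: ler_sum => y _.
have := marginalY_ge0 y; rewrite le_eqVlt => /predU1P[<-|q0]; first by rewrite mul0r.
rewrite ler_peMr ?(ltW q0) // -[leLHS](sum_nth_sorted_cond_prob q0).
by apply: ler_sum => i _; rewrite ler_peMl ?nth_sorted_cond_prob_ge0 // ler1n.
Qed.

(** [entropy_le_mean_rank] is applied for every y with the same m = G - 1/2. The mean ranks average
    to G over y, so the first term becomes m / m = 1. *)
Lemma cond_entropy_le_guessing :
  - (\sum_x \sum_y P x y * (ln (P x y) - ln (marginalY P y)))
    <= 1 + ln (guessing_entropy P - 1 / 2).
Proof.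
set m := _ - 1 / 2; have G1 := guessing_entropy_ge1.
have m0 : 0 < m by rewrite /m; lra.
have -> : 1 + ln m = \sum_y marginalY P y *
   ((\sum_(i < #|X|) i.+1%:R * nth 0 (sorted_cond_prob P y) i - 1 / 2) / m + ln m).
  transitivity (m / m + ln m); first by rewrite divff ?gt_eqF.
  under [RHS]eq_bigr => y _ do rewrite mulrDr mulrA mulrBr.
  rewrite big_split /= -!mulr_suml sumrB -mulr_suml sum_marginalY mul1r.
  by rewrite [1 * ln m]mul1r.
rewrite exchange_big -sumrN; apply: ler_sum => y _.
have := marginalY_ge0 y; rewrite le_eqVlt => /predU1P[q0|q0].
  rewrite -q0 mul0r big1 ?oppr0 // => x _.
  have /psumr_eq0P P0 := esym q0; rewrite P0 ?mul0r // => ? _; exact: P_ge0.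
apply: le_trans (ler_wpM2l (ltW q0) (entropy_le_mean_rank m0
  (fun i _ => nth_sorted_cond_prob_ge0 y i) (sum_nth_sorted_cond_prob q0))).
rewrite (sum_sorted_cond_prob y (fun c => c * ln c)) mulrN lerN2 mulr_sumr.
apply: ler_sum => x _; rewrite /cond_prob.
have := P_ge0 x y; rewrite le_eqVlt => /predU1P[<-|Pxy].
  by rewrite !mul0r mulr0.
by rewrite ln_div // mulrA mulrCA divff ?gt_eqF ?mulr1.
Qed.

End GuessingEntropy.

Section Holevo.
Variables (R : realType) (d : nat) (X Y : finType) (p : X -> R).
Variables (rho : X -> 'M[R[i]]_d) (E : Y -> 'M[R[i]]_d).
Hypotheses (p_distr : is_distribution p) (rho_density : forall x, is_density (rho x)).
Hypothesis E_povm : is_povm E.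
Let sigma := \sum_x (p x)%:C *: rho x.
Let p_ge0 x : 0 <= p x := p_distr.1 x.
Let rho_psd x : psd (rho x) := (rho_density x).1.

Let ln2_gt0 : 0 < ln 2 :> R. Proof. by rewrite ln_gt0 // ltr1n. Qed.

Lemma psd_average : psd sigma.
Proof. by apply: psd_sum => x _; exact: psdZ (p_ge0 x) (rho_psd x). Qed.

Lemma sum_outcome_prob_density x : \sum_y outcome_prob E (rho x) y = 1.
Proof. by rewrite sum_outcome_prob // (rho_density x).2. Qed.

Lemma outcome_prob_average y :
  outcome_prob E sigma y = \sum_x p x * outcome_prob E (rho x) y.
Proof.
rewrite /outcome_prob mulmx_sumr mxtrace_sum Re_sum; apply: eq_bigr => x _.
by rewrite -scalemxAr mxtraceZ ReZ.
Qed.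

(** The difference is the sum of the other p_z rho_z, divided by p_x. It supplies the domination
    constant c = 1 / p_x. *)
Lemma psd_average_sub x : 0 < p x -> psd ((p x)^-1%:C *: sigma - rho x).
Proof.
move=> px; rewrite /sigma (bigD1 x) //= scalerDr scalerA -rmorphM mulVf ?gt_eqF //.
rewrite scale1r addrAC subrr add0r; apply: psdZ; first by rewrite invr_ge0 ltW.
by apply: psd_sum => z _; exact: psdZ (p_ge0 z) (rho_psd z).
Qed.

Lemma von_neumann_entropyE (A : 'M[R[i]]_d) :
  von_neumann_entropy A * ln 2 = - \sum_k eig A k * ln (eig A k).
Proof.
rewrite /von_neumann_entropy mulNr mulr_suml; congr (- _).
by apply: eq_bigr => k _; rewrite /log2 mulrA divfK ?gt_eqF.
Qed.

Lemma shannon_entropyE : shannon_entropy p * ln 2 = - \sum_x p x * ln (p x).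
Proof.
rewrite /shannon_entropy mulNr mulr_suml; congr (- _).
by apply: eq_bigr => k _; rewrite /log2 mulrA divfK ?gt_eqF.
Qed.

(** The left side is the mutual information of X and the outcome. On the right, averaging the
    diagonals of the rho_x in the eigenbasis of [sigma] gives the eigenvalues of [sigma], so chi is
    the mean of D(rho_x || sigma); each term decreases under measurement. *)
Lemma holevo_bound :
  \sum_x p x * \sum_y outcome_prob E (rho x) y *
      (ln (outcome_prob E (rho x) y) - ln (outcome_prob E sigma y))
  <= holevo_information p rho * ln 2.
Proof.
have -> : holevo_information p rho * ln 2 = \sum_x p x *
    (\sum_i eig (rho x) i * ln (eig (rho x) i)
     - \sum_j complex.Re (diag_coef (spectralmx sigma) (rho x) j) * ln (eig sigma j)).
  rewrite mulrBl von_neumann_entropyE mulr_suml.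
  under [RHS]eq_bigr do rewrite mulrBr.
  rewrite sumrB addrC; congr (_ - _).
    rewrite -sumrN; apply: eq_bigr => x _.
    by rewrite -mulrA von_neumann_entropyE mulrN opprK.
  under [RHS]eq_bigr do rewrite mulr_sumr.
  rewrite exchange_big /=; apply: eq_bigr => j _.
  under [RHS]eq_bigr do rewrite mulrA.
  rewrite -mulr_suml; congr (_ * _).
  have := diag_coef_spectral j psd_average.
  move=> /(congr1 (@complex.Re R)) /= <-.
  rewrite /diag_coef /sigma mulmx_sumr mulmx_suml summxE Re_sum.
  by apply: eq_bigr => x _; rewrite -scalemxAr -scalemxAl mxE ReZ.
apply: ler_sum => x _.
have := p_ge0 x; rewrite le_eqVlt => /predU1P[<-|px]; first by rewrite !mul0r.
rewrite ler_pM2l //.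
exact: measured_relative_entropy_le (rho_psd x) psd_average (psd_average_sub px).
Qed.

Lemma marginalY_measured_joint y :
  marginalY (measured_joint p rho E) y = outcome_prob E sigma y.
Proof. by rewrite outcome_prob_average. Qed.

Lemma measured_joint_ge0 x y : 0 <= measured_joint p rho E x y.
Proof. by rewrite mulr_ge0 ?p_ge0 //; exact: outcome_prob_ge0. Qed.

Lemma sum_measured_joint x : \sum_y measured_joint p rho E x y = p x.
Proof. by rewrite -mulr_sumr sum_outcome_prob_density mulr1. Qed.

(** H(X|Y) = H(X) - I(X;Y), and Holevo's bound gives I(X;Y) <= chi; the factor ln 2 converts bits to
    nats. *)
Lemma entropy_sub_holevo_le :
  (shannon_entropy p - holevo_information p rho) * ln 2
  <= - (\sum_x \sum_y measured_joint p rho E x y *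
      (ln (measured_joint p rho E x y) - ln (marginalY (measured_joint p rho E) y))).
Proof.
rewrite mulrBl shannon_entropyE -opprD lerN2.
apply: le_trans (lerD (lexx _) holevo_bound).
rewrite -big_split /=; apply: ler_sum => x _.
rewrite -{1}(sum_measured_joint x) mulr_suml mulr_sumr -big_split /=.
apply: ler_sum => y _; rewrite marginalY_measured_joint.
rewrite /measured_joint -/(outcome_prob E (rho x) y).
have := p_ge0 x; rewrite le_eqVlt => /predU1P[<-|px]; first by rewrite !mul0r addr0.
have := outcome_prob_ge0 E_povm y (rho_psd x).
rewrite le_eqVlt => /predU1P[<-|t0]; first by rewrite !(mulr0, mul0r) addr0.
by rewrite lnM //; lra.
Qed.

Lemma guessing_entropy_measured_ge :
  2 `^ (shannon_entropy p - holevo_information p rho) / expR 1 + 1 / 2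
    <= guessing_entropy (measured_joint p rho E).
Proof.
have P1 : \sum_x \sum_y measured_joint p rho E x y = 1.
  by rewrite -p_distr.2; apply: eq_bigr => x _; exact: sum_measured_joint.
have G1 := guessing_entropy_ge1 measured_joint_ge0 P1.
have H := le_trans entropy_sub_holevo_le
  (cond_entropy_le_guessing measured_joint_ge0 P1).
(* The claim becomes exp((H - chi) ln 2 - 1) <= exp(ln (G - 1/2)), where [G1] makes the logarithm
   legitimate. *)
rewrite -lerBrDr /powR pnatr_eq0 /= -expRN -expRD.
by rewrite -[leRHS]lnK ?posrE ?ler_expR; lra.
Qed.

End Holevo.

Theorem mainTheorem6 (R : realType) (d : nat) (X : finType)
    (p : X -> R) (rho : X -> 'M[R[i]]_d)
    (p_distr : is_distribution p)
    (rho_density : forall x : X, is_density (rho x)) :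
  quantum_guesswork p rho >=
    2 `^ (shannon_entropy p - holevo_information p rho) / expR 1 + 1 / 2.
Proof.
apply: lb_le_inf; last first.
  by move=> _ [Y [E [E_povm ->]]]; exact: guessing_entropy_measured_ge.
(* The one-outcome POVM {I} shows that the infimum is over a nonempty set. *)
exists (guessing_entropy (measured_joint p rho (fun _ : unit => 1%:M))).
exists unit, (fun=> 1%:M); split => //; split=> [_|]; first exact: psd1.
by rewrite big_const card_unit /= addr0.
Qed.
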